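(* Let $D=(E,s,t)$ be a demi-matroid on $E=\{1,\dots,n\}$ and let $f\in\mathrm{Harm}_d(n)$. Then: (i) $T(D^\ast,f;x,y)=(-1)^d\,T(D,f;y,x)$; (ii) $T(\overline D,f;x,y)=(-1)^d\,(x-1)^{s(E)}(y-1)^{t(E)}\,T\!\left(D,f;\dfrac{x}{x-1},\dfrac{y}{y-1}\right)$.
   Context: Let $E=\{1,\dots,n\}$, let $0\le d\le n$, and let $E_d$ be the set of $d$-element subsets of $E$. $\mathbb{R}E_d$ is the real vector space with basis $E_d$; its elements $f=\sum_{Z\in E_d}f(Z)Z$ are identified with functions $E_d\to\mathbb{R}$. The linear map $\gamma$ on $\mathbb{R}E_d$ is given by $\gamma(Z)=\sum_{Y\in E_{d-1},\,Y\subseteq Z}Y$ for $Z\in E_d$ (and $\gamma=0$ if $d=0$), and $\mathrm{Harm}_d(n)=\ker(\gamma|_{\mathbb{R}E_d})$ (the harmonic functions of degree $d$). For $f\in\mathbb{R}E_d$ and $X\subseteq E$ put $\widetilde f(X)=\sum_{Z\in E_d,\,Z\subseteq X}f(Z)$. A (real) demi-matroid is a triple $D=(E,s,t)$ with functions $s,t:2^E\to\mathbb{R}$ such that: (D1) if $X\subseteq Y\subseteq E$ then $0\le s(X)\le s(Y)\le|Y|$ and $0\le t(X)\le t(Y)\le|Y|$; (D2) if $X\subseteq E$ then $|E-X|-s(E-X)=t(E)-t(X)$. Its dual is $D^\ast=(E,t,s)$ and its supplement is $\overline D=(E,\overline s,\overline t)$, where $\overline g(X)=g(E)-g(E-X)$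 for $g:2^E\to\mathbb{R}$; both are again demi-matroids. The harmonic Tutte polynomial of $D$ associated with $f\in\mathrm{Harm}_d(n)$ is $$T(D,f;x,y)=\sum_{X\subseteq E}\widetilde f(X)(x-1)^{s(E)-s(X)}(y-1)^{|X|-s(X)}.$$ Since exponents may be non-integral reals, the variables $x,y$ are read as real numbers with $x>1$, $y>1$. *)

(* Defs.v *)
From HB Require Import structures.
From mathcomp Require Import all_boot all_order all_algebra.
From mathcomp Require Import lra.
From mathcomp Require Import reals exp.

Set Implicit Arguments.
Unset Strict Implicit.
Unset Printing Implicit Defensive.

Import Order.TTheory GRing.Theory Num.Theory.
Local Open Scope ring_scope.

(* The ground set E is 'I_n, the complement E - X is ~: X and E itself is
   [set: 'I_n]. *)

Notation Esub n d := {Z : {set 'I_n} | #|Z| == d}.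

(* R^o, i.e. R as a module over itself, makes this an R-vector space. *)
Notation RE R n d := {ffun Esub n d -> R^o}.

Section Harmonic.
Variables (R : realType) (n d : nat).

Definition basisE (k : nat) (Z : Esub n k) : RE R n k :=
  [ffun Y => (Y == Z)%:R].

(* The case d = 0 is separate because d.-1 = 0 there. *)
Definition gamma (f : RE R n d) : RE R n d.-1 :=
  if d == 0%N then 0
  else \sum_(Z : Esub n d)
         f Z *: \sum_(Y : Esub n d.-1 | val Y \subset val Z) basisE Y.

Lemma gamma_is_linear : linear gamma.
Proof.
move=> a f g; rewrite /gamma; case: (d == 0%N).
  by rewrite scaler0 addr0.
rewrite scaler_sumr -big_split /=; apply: eq_bigr => Z _.
by rewrite !ffunE scalerDl scalerA.
Qed.

HB.instance Definition _ :=
  GRing.isLinear.Build R (RE R n d) (RE R n d.-1) _ gamma gamma_is_linear.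

Definition Harm : {vspace RE R n d} := lker (linfun gamma).

Definition ftilde (f : RE R n d) (X : {set 'I_n}) : R :=
  \sum_(Z : Esub n d | val Z \subset X) f Z.

End Harmonic.

Record demimatroid (R : realType) (n : nat) := DemiMatroid {
  dm_s : {set 'I_n} -> R;
  dm_t : {set 'I_n} -> R;
  dm_D1 : forall X Y : {set 'I_n}, X \subset Y ->
    [/\ 0 <= dm_s X, dm_s X <= dm_s Y & dm_s Y <= #|Y|%:R] /\
    [/\ 0 <= dm_t X, dm_t X <= dm_t Y & dm_t Y <= #|Y|%:R];
  dm_D2 : forall X : {set 'I_n},
    #|~: X|%:R - dm_s (~: X) = dm_t [set: 'I_n] - dm_t X
}.

Section Operations.
Variables (R : realType) (n : nat).
Implicit Types (D : demimatroid R n) (X Y : {set 'I_n}).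

Definition sbar (g : {set 'I_n} -> R) (X : {set 'I_n}) : R :=
  g [set: 'I_n] - g (~: X).

Lemma dm_t0 D : dm_t D set0 = 0.
Proof.
have [_ [t0 _]] := dm_D1 D (subxx set0).
by rewrite cards0 => t0'; apply: le_anti; rewrite t0 t0'.
Qed.

Lemma dual_D1 D X Y : X \subset Y ->
  [/\ 0 <= dm_t D X, dm_t D X <= dm_t D Y & dm_t D Y <= #|Y|%:R] /\
  [/\ 0 <= dm_s D X, dm_s D X <= dm_s D Y & dm_s D Y <= #|Y|%:R].
Proof. by move=> /(dm_D1 D) []. Qed.

Lemma cardCR X : #|~: X|%:R = #|[set: 'I_n]|%:R - #|X|%:R :> R.
Proof. by rewrite cardsT -(cardsC X) natrD; lra. Qed.

Lemma dual_D2 D X :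
  #|~: X|%:R - dm_t D (~: X) = dm_s D [set: 'I_n] - dm_s D X.
Proof.
have := dm_D2 D (~: X); have := dm_D2 D set0.
rewrite setCK setC0 dm_t0 cardCR; lra.
Qed.

Definition dual D : demimatroid R n := DemiMatroid (@dual_D1 D) (@dual_D2 D).

Lemma suppl_D1 D X Y : X \subset Y ->
  [/\ 0 <= sbar (dm_s D) X, sbar (dm_s D) X <= sbar (dm_s D) Y
    & sbar (dm_s D) Y <= #|Y|%:R] /\
  [/\ 0 <= sbar (dm_t D) X, sbar (dm_t D) X <= sbar (dm_t D) Y
    & sbar (dm_t D) Y <= #|Y|%:R].
Proof.
move=> XY; rewrite /sbar.
have [[_ sX _] [_ tX _]] := dm_D1 D (subsetT (~: X)).
have [[_ sXY _] [_ tXY _]] := dm_D1 D (etrans (setCS Y X) XY).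
have [[sY _ _] [tY _ _]] := dm_D1 D (subsetT Y).
have := dm_D2 D (~: Y); have := dual_D2 D (~: Y); rewrite setCK => e1 e2.
by split; split; lra.
Qed.

Lemma suppl_D2 D X :
  #|~: X|%:R - sbar (dm_s D) (~: X) =
  sbar (dm_t D) [set: 'I_n] - sbar (dm_t D) X.
Proof.
have := dual_D2 D X; rewrite /sbar setCT setCK dm_t0; lra.
Qed.

Definition supplement D : demimatroid R n :=
  DemiMatroid (@suppl_D1 D) (@suppl_D2 D).

(* Real exponents: a `^ r = exp (r ln a) for a > 0, so this is the intended
   function only for x, y > 1. *)
Definition Tutte (d : nat) D (f : RE R n d) (x y : R) : R :=
  \sum_(X : {set 'I_n})
    ftilde f X * (x - 1) `^ (dm_s D [set: 'I_n] - dm_s D X)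
               * (y - 1) `^ (#|X|%:R - dm_s D X).

End Operations.

(* Main.v *)
Require Import Defs.
From mathcomp Require Import all_boot all_order all_algebra.
From mathcomp Require Import lra.
From mathcomp Require Import reals exp.

Import Order.TTheory GRing.Theory Num.Theory.
Local Open Scope ring_scope.

(** Everything rests on one symmetry of harmonic functions: the sum of [f] over
    the [d]-sets inside [X] and the sum over the [d]-sets inside [~: X] agree up
    to the sign [(-1) ^+ d] ([ftilde_setC]).  Given this, substituting [~: X]
    for [X] in the sum defining the left-hand side of either identity turns it
    term by term into the right-hand side; only the exponents remain to be
    compared.  Writing corank for [g E - g X] and nullity for [#|X| - g X], (D2)
    says that complementation swaps them between [s] and [t], which gives the
    duality.  For the supplement, the corank and nullity of [sbar s] at [~: X]
    are [s E] minus the corank, and [t E] minus the nullity, of [s] at [X].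

    For the symmetry, let [profile f X i] be the sum of [f] over the [d]-sets
    meeting [X] in [i] points; the two sums to compare are the values at [d] and
    at [0].  Being harmonic means that [f] is orthogonal to every function on
    [d]-sets of the form [Z |-> \sum_(z in Z) g (Z :\ z)].  Taking for [g] the
    indicator of the sets meeting [X] in [i] points yields a two-term recurrence
    between the profile at [i] and at [i.+1] ([profile_recurrence]), which
    forces [profile f X i] to be [(-1) ^+ i * 'C(d, i)] times its value at
    [0]. *)

(** * Harmonic functions and complementation *)

Section HarmonicSums.
Variables (R : realType) (n d : nat).
Implicit Types (f : RE R n d) (X : {set 'I_n}) (g : {set 'I_n} -> R).

(** The facets of a [d]-set [Z] are the sets [Z :\ z], each obtained from
    exactly one [z]. *)
Lemma sum_facets g (Z : {set 'I_n}) (hd : (0 < d)%N) : #|Z| = d ->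
  \sum_(Y : Esub n d.-1 | val Y \subset Z) g (val Y) = \sum_(z in Z) g (Z :\ z).
Proof.
move=> cardZ.
rewrite -(big_sub_cond [pred Y : {set 'I_n} | #|Y| == d.-1]
            (fun Y : {set 'I_n} => Y \subset Z)) /=.
rewrite -(big_imset (h := fun z => Z :\ z)) /=; last first.
  move=> z w zZ wZ /setP /(_ z).
  by rewrite !inE eqxx zZ !andbT => /esym/negbFE/eqP.
apply: eq_bigl => Y; rewrite !inE; apply/andP/imsetP => [[/eqP cardY YZ]|].
  have /cards1P[z ZYz] : #|Z :\: Y| == 1%N.
    by rewrite cardsDS // cardZ cardY -subn1 subKn.
  have : z \in Z :\: Y by rewrite ZYz set11.
  rewrite inE => /andP[_ zZ]; exists z => //.
  by rewrite -ZYz setDDr setDv set0U; apply/esym/setIidPr.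
move=> [z zZ ->]; split; last exact: subsetDl.
by rewrite -cardZ (cardsD1 z Z) zZ.
Qed.

Lemma gammaE f (Y : Esub n d.-1) : (0 < d)%N ->
  gamma f Y = \sum_(Z : Esub n d | val Y \subset val Z) f Z.
Proof.
rewrite lt0n /gamma => /negbTE ->; rewrite sum_ffunE [RHS]big_mkcond.
apply: eq_bigr => Z _; rewrite ffunE sum_ffunE big_mkcond (bigD1 Y) //=.
rewrite big1 => [|W WY]; last first.
  by case: ifP => // _; rewrite ffunE eq_sym (negbTE WY).
by rewrite addr0 ffunE eqxx; case: ifP; rewrite ?scaler0 // => _; apply: mulr1.
Qed.

(** This is the adjoint form of [gamma f = 0]: pairing [gamma f] with [g] is
    pairing [f] with the facet sums of [g]. *)
Lemma harmonic_orthogonal f g : f \in Harm R n d ->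
  \sum_(Z : Esub n d) f Z * \sum_(z in val Z) g (val Z :\ z) = 0.
Proof.
rewrite memv_ker lfunE /= => /eqP gamma_f.
have [d0|d_gt0] := posnP d.
  rewrite big1 // => Z _; rewrite (_ : val Z = set0) ?big_set0 ?mulr0 //.
  by apply/eqP; rewrite -cards_eq0 (eqP (valP Z)) d0.
transitivity (\sum_(Y : Esub n d.-1) gamma f Y * g (val Y)); last first.
  by rewrite gamma_f big1 // => Y _; rewrite ffunE mul0r.
under [RHS]eq_bigr => Y _ do rewrite gammaE // mulr_suml.
rewrite (exchange_big_dep xpredT) //=; apply: eq_bigr => Z _.
by rewrite -(sum_facets _ _ d_gt0 (eqP (valP Z))) mulr_sumr.
Qed.

Definition profile f X (i : nat) : R :=
  \sum_(Z : Esub n d | #|val Z :&: X| == i) f Z.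

(** A facet [Z :\ z] meets [X] in [i] points in two ways: [Z] meets [X] in
    [i.+1] points and [z] is one of them, or [Z] meets [X] in [i] points and [z]
    is one of the [d - i] points of [Z] outside [X]. *)
Lemma profile_recurrence f X (i : nat) : f \in Harm R n d ->
  i.+1%:R * profile f X i.+1 = - ((d - i)%:R * profile f X i).
Proof.
move=> hf; apply/eqP; rewrite -addr_eq0; apply/eqP.
rewrite -[RHS](harmonic_orthogonal _ (fun Y => (#|Y :&: X| == i)%:R) hf).
rewrite /profile !mulr_sumr ![\sum_(_ | _ == _) _]big_mkcond -big_split /=.
apply: eq_bigr => Z _; rewrite (big_setID X) /= mulrDr; congr (_ + _).
  under eq_bigr => z zZX.
    rewrite setIDAC (_ : (_ == i) = (#|val Z :&: X| == i.+1)); last first.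
      by rewrite (cardsD1 z (val Z :&: X)) zZX.
    over.
  by rewrite sumr_const; case: eqP => [->|_]; rewrite ?mul0rn ?mulr0 // mulrC.
under eq_bigr => z.
  rewrite inE => /andP[zX _].
  rewrite setIDAC (setDidPl _); last first.
    by rewrite disjoint_sym disjoints1 inE (negbTE zX) andbF.
  over.
rewrite sumr_const cardsD (eqP (valP Z)).
by case: eqP => [->|_]; rewrite ?mul0rn ?mulr0 // mulrC.
Qed.

Lemma profileE f X (i : nat) : f \in Harm R n d ->
  profile f X i = (-1) ^+ i * 'C(d, i)%:R * profile f X 0.
Proof.
move=> hf; elim: i => [|i IHi]; first by rewrite bin0 !mul1r.
apply: (mulfI (_ : i.+1%:R != 0 :> R)); first by rewrite pnatr_eq0.
have := congr1 (fun k => k%:R : R) (mul_bin_left d i); rewrite !natrM => binE.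
rewrite profile_recurrence // IHi exprS mulN1r !mulNr mulrN; congr (- _).
rewrite !mulrA ![_%:R * _ ^+ i]mulrC.
by rewrite -[in LHS](mulrA _ _ 'C(d, i)%:R) -binE mulrA.
Qed.

Lemma ftilde_setC f X : f \in Harm R n d ->
  ftilde f (~: X) = (-1) ^+ d * ftilde f X.
Proof.
move=> hf.
have -> : ftilde f X = profile f X d.
  apply: eq_bigl => Z; rewrite -[X in _ == X](eqP (valP Z)).
  apply/setIidPl/eqP => [-> //|cardZX].
  by apply/eqP; rewrite eqEcard subsetIl cardZX /=.
have -> : ftilde f (~: X) = profile f X 0.
  by apply: eq_bigl => Z; rewrite cards_eq0 setI_eq0 disjoints_subset.
by rewrite (profileE f X d hf) binn mulr1 mulrA -expr2 sqrr_sign mul1r.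
Qed.

End HarmonicSums.

(** * The two identities *)

Section Tutte.
Variables (R : realType) (n : nat).
Implicit Types (D : demimatroid R n).

Lemma dm_s0 D : dm_s D set0 = 0.
Proof. exact: dm_t0 (dual D). Qed.

Lemma Tutte_setC d D (f : RE R n d) (x y : R) : f \in Harm R n d ->
  Tutte D f x y = (-1) ^+ d * \sum_(X : {set 'I_n})
    ftilde f X * (x - 1) `^ (dm_s D [set: 'I_n] - dm_s D (~: X))
               * (y - 1) `^ (#|~: X|%:R - dm_s D (~: X)).
Proof.
move=> hf; rewrite /Tutte (reindex_inj (@setC_inj _)) mulr_sumr.
by apply: eq_bigr => X _; rewrite ftilde_setC // !mulrA.
Qed.

Lemma Tutte_dual d D (f : RE R n d) (x y : R) : f \in Harm R n d ->
  Tutte (dual D) f x y = (-1) ^+ d * Tutte D f y x.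
Proof.
move=> hf; rewrite Tutte_setC //; congr (_ * _); apply: eq_bigr => X _ /=.
by rewrite -dm_D2 setCK dual_D2 mulrAC.
Qed.

(** Since [x / (x - 1) - 1 = (x - 1)^-1], the powers on the right have the
    exponents of [Tutte D f] negated, and the prefactor shifts them by [s E] and
    [t E]. *)
Lemma Tutte_supplement d D (f : RE R n d) (x y : R) :
  f \in Harm R n d -> 1 < x -> 1 < y ->
  Tutte (supplement D) f x y =
    (-1) ^+ d * (x - 1) `^ (dm_s D [set: 'I_n])
              * (y - 1) `^ (dm_t D [set: 'I_n])
              * Tutte D f (x / (x - 1)) (y / (y - 1)).
Proof.
move=> hf hx hy.
have inv_base (z r : R) : 1 < z ->
    (z / (z - 1) - 1) `^ r = (z - 1) `^ (- r).
  move=> z1; have z10 : 0 < z - 1 by rewrite subr_gt0.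
  rewrite -[- r]mulN1r powRrM powR_inv1 ?ltW //; congr (_ `^ _).
  have -> : z / (z - 1) = ((z - 1) + 1) / (z - 1) by rewrite subrK.
  by rewrite mulrDl divff ?gt_eqF // mul1r addrC addKr.
rewrite Tutte_setC // -!mulrA; congr (_ * _); rewrite /Tutte !mulr_sumr.
apply: eq_bigr => X _; rewrite !inv_base //.
have x0 : x - 1 != 0 by rewrite gt_eqF // subr_gt0.
have y0 : y - 1 != 0 by rewrite gt_eqF // subr_gt0.
have powD (z r s : R) : z != 0 -> z `^ (r + s) = z `^ r * z `^ s.
  by move=> z0; rewrite powRD // z0 implybT.
rewrite /= /sbar setCT setCK dm_s0.
have -> : dm_s D [set: 'I_n] - 0 - (dm_s D [set: 'I_n] - dm_s D X) =
    dm_s D [set: 'I_n] + - (dm_s D [set: 'I_n] - dm_s D X) by lra.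
have -> : #|~: X|%:R - (dm_s D [set: 'I_n] - dm_s D X) =
    dm_t D [set: 'I_n] + - (#|X|%:R - dm_s D X).
  (* (D2) at the empty set reads t(E) = #|E| - s(E). *)
  have := dm_D2 D set0; rewrite setC0 dm_t0 cardCR; lra.
rewrite !powD //; lra.
Qed.

End Tutte.

Theorem theorem4p1 (R : realType) (n d : nat) (hd : (d <= n)%N)
  (D : demimatroid R n) (f : RE R n d) (hf : f \in Harm R n d)
  (x y : R) (hx : 1 < x) (hy : 1 < y) :
  Tutte (dual D) f x y = (-1) ^+ d * Tutte D f y x
  /\
  Tutte (supplement D) f x y =
    (-1) ^+ d * (x - 1) `^ (dm_s D [set: 'I_n])
              * (y - 1) `^ (dm_t D [set: 'I_n])
              * Tutte D f (x / (x - 1)) (y / (y - 1)).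
Proof.
by split; [exact: Tutte_dual | exact: Tutte_supplement].
Qed.
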